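(* Let $(D,S,t_{\max})$ and $(D',S',t'_{\max})$ both satisfy the standing assumptions below with the same initial moment $t_{\min}$, and let $0\le k_{\min}<k_{\max}$. If their far-field patterns satisfy $w^\infty(\hat x,k)=w'^\infty(\hat x,k)$ for all $\hat x\in\mathbb S^2$ and all $k\in[k_{\min},k_{\max}]$, then $\mathrm{ch}(D)=\mathrm{ch}(D')$, where $\mathrm{ch}$ denotes the convex hull.
   Context: Standing assumptions on $(D,S,t_{\max})$: $D\subset\mathbb R^3$ is a bounded Lipschitz domain (open, connected) with $\mathbb R^3\setminus\overline D$ connected; $0\le t_{\min}<t_{\max}$; $S\in C([t_{\min},t_{\max}];L^\infty(D))$ is real-valued with $S\ge c_0>0$ a.e. on $D\times[t_{\min},t_{\max}]$ for some $c_0>0$. Far-field pattern: $w^\infty(\hat x,k)=\frac{1}{\sqrt{2\pi}}\int_{t_{\min}}^{t_{\max}}\int_D e^{{\rm i}k(t-\hat x\cdot y)}S(y,t)\,dy\,dt$, $\hat x\in\mathbb S^2$, $k\in\mathbb R$. *)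

(* Defs.v *)
From HB Require Import structures.
From mathcomp Require Import all_boot all_order all_algebra.
From mathcomp Require Import all_classical all_reals all_analysis.
Set Implicit Arguments. Unset Strict Implicit. Unset Printing Implicit Defensive.
Import Order.TTheory GRing.Theory Num.Theory numFieldNormedType.Exports.
Local Open Scope classical_set_scope.
Local Open Scope ring_scope.

Section Defs.
Variable R : realType.

Definition pt := ((R * R) * R)%type.
Definition c1 (y : pt) : R := y.1.1.
Definition c2 (y : pt) : R := y.1.2.
Definition c3 (y : pt) : R := y.2.
Definition mkpt (a b c : R) : pt := ((a, b), c).

Definition vol3 := ((@lebesgue_measure R \x @lebesgue_measure R) \x @lebesgue_measure R)%E.

Definition dot3 (x y : pt) : R := c1 x * c1 y + c2 x * c2 y + c3 x * c3 y.
Definition sub3 (x y : pt) : pt := mkpt (c1 x - c1 y) (c2 x - c2 y) (c3 x - c3 y).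
Definition on_sphere2 (x : pt) : Prop := dot3 x x = 1.

Definition tovec (y : pt) : 'rV[R]_3 :=
  \row_(i < 3) (if val i == 0%N then c1 y else if val i == 1%N then c2 y else c3 y).

Definition bounded3 (D : set pt) : Prop :=
  exists M : R, forall y, D y -> `|c1 y| <= M /\ `|c2 y| <= M /\ `|c3 y| <= M.

Definition boundary3 (D : set pt) : set pt := closure D `&` closure (~` D).

(* Lipschitz domain (boundary locally the graph of a Lipschitz function in a
   rotated (orthonormal) coordinate system, with D lying on one side). *)
Definition lipschitz_boundary (D : set pt) : Prop :=
  forall x, boundary3 D x ->
  exists (Q : 'M[R]_3) (W : set pt) (g : R -> R -> R) (L : R),
    [/\ Q *m Q^T = 1%:M, open W, W x,
        (forall a b a' b', `|g a b - g a' b'| <= L * Num.sqrt ((a - a') ^+ 2 + (b - b') ^+ 2)) &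
        (forall y, W y ->
           (D y <-> let z := tovec (sub3 y x) *m Q in z 0 2%:R < g (z 0 0) (z 0 1%:R)))].

Definition bounded_lipschitz_domain (D : set pt) : Prop :=
  [/\ open D, connected D, D !=set0, bounded3 D & lipschitz_boundary D].

Definition convex3 (C : set pt) : Prop :=
  forall x y (l : R), C x -> C y -> 0 <= l <= 1 ->
    C (mkpt (l * c1 x + (1 - l) * c1 y) (l * c2 x + (1 - l) * c2 y)
            (l * c3 x + (1 - l) * c3 y)).
Definition convex_hull3 (A : set pt) : set pt :=
  [set y | forall C, convex3 C -> A `<=` C -> C y].

(* Standing assumptions on (D, S, tmin, tmax). S y t = S(y,t).
   S in C([tmin,tmax]; L^oo(D)), S >= c0 > 0 a.e. *)
Definition source_assumptions (D : set pt) (S : pt -> R -> R) (tmin tmax : R) : Prop :=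
  [/\ bounded_lipschitz_domain D /\ connected (~` closure D), 0 <= tmin < tmax,
      (forall t, tmin <= t <= tmax ->
         measurable_fun D (fun y => S y t) /\
         exists M : R, {ae vol3, forall y, D y -> `|S y t| <= M}),
      (forall t0, tmin <= t0 <= tmax -> forall e : R, 0 < e ->
         exists2 d : R, 0 < d & forall t, tmin <= t <= tmax -> `|t - t0| < d ->
           {ae vol3, forall y, D y -> `|S y t - S y t0| <= e}) &
      exists2 c0 : R, 0 < c0 & forall t, tmin <= t <= tmax ->
         {ae vol3, forall y, D y -> c0 <= S y t}].

(* Far-field pattern: (real part, imaginary part) of
   1/sqrt(2 pi) * int_tmin^tmax int_D e^{ik(t - xh.y)} S(y,t) dy dt. *)
Definition farfield (D : set pt) (S : pt -> R -> R) (tmin tmax : R) (xh : pt) (k : R) : R * R :=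
  ( (Num.sqrt (2 * pi))^-1 *
      Rintegral (@lebesgue_measure R) `[tmin, tmax]
        (fun t => Rintegral vol3 D (fun y => cos (k * (t - dot3 xh y)) * S y t)),
    (Num.sqrt (2 * pi))^-1 *
      Rintegral (@lebesgue_measure R) `[tmin, tmax]
        (fun t => Rintegral vol3 D (fun y => sin (k * (t - dot3 xh y)) * S y t)) ).

End Defs.

(* Main.v *)
Require Import Defs.
From HB Require Import structures.
From mathcomp Require Import all_boot all_order all_algebra.
From mathcomp Require Import all_classical all_reals all_analysis.
From mathcomp Require Import measurable_realfun ring lra.
Set Implicit Arguments. Unset Strict Implicit. Unset Printing Implicit Defensive.
Import Order.TTheory GRing.Theory Num.Theory numFieldNormedType.Exports.
Local Open Scope classical_set_scope.
Local Open Scope ring_scope.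

(** Fix a direction [xh]. The far field is the Fourier transform in [k] of the
    distribution of the delay [tau = t - xh.y] under the positive density [S];
    the delays are bounded, so differentiating in [k] inside
    ]kmin, kmax[ and using cos^2 + sin^2 = 1 shows that the data determine all
    moments of this distribution. Testing with (B - tau)^n for large n recovers
    the infimum tmin - sup_D xh.y of the support, because [S] is bounded below.
    Hence D and D' lie in the same half-spaces, and since they are open they
    have the same convex hull. *)

(** * Functionals annihilating the trigonometric functions of a frequency band *)

Section Fourier.
Context {R : realType}.
Implicit Types (f g : R -> R) (M e k x a b : R) (p : {poly R}).

(** No measure on the line is formed: the law of the delay is represented by the linear functional
    sending [f] to the iterated integral of f(t - xh.y) S(y,t), for locally Lipschitz [f]. This
    suits the assumptions, which give measurability of [S] in y for each t and continuity in t with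
    values in L^oo: a Lipschitz [f] makes the inner integral continuous in t, so the outer integral
    makes sense. The difference of the two functionals is signed, so it only serves to show that the
    moments agree; the growth of the moments is then estimated for each positive functional
    separately. The lower end of the delays depends on [tmin] and the domain alone, whereas the
    upper end involves the final time; this is why the final times may differ. Weak inequalities for
    half-spaces determine a convex set only up to closure; openness of both domains is what removes
    the closure. *)

Lemma mean_value (f df : R -> R) : (forall x : R, is_derive x (1 : R) f (df x)) ->
  forall a b, exists2 c, `|c - a| <= `|b - a| & f b - f a = df c * (b - a).
Proof.
move=> fdf.
have fc : continuous f.
  by move=> z; apply/differentiable_continuous/derivable1_diffP; have [] := fdf z.
have MV a b : a <= b -> exists2 c, c \in `[a, b]%R & f b - f a = df c * (b - a).
  by move=> ab; apply: (@MVT_segment R f df) => //; exact: continuous_subspaceT.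
move=> a b; case: (leP a b) => [ab|/ltW ba].
  have [c] := MV _ _ ab; rewrite in_itv/= => /andP[ac cb] ->.
  by exists c => //; rewrite !ger0_norm ?subr_ge0// lerB.
have [c] := MV _ _ ba; rewrite in_itv/= => /andP[bc ca] E.
exists c; last by rewrite -opprB E; ring.
by rewrite !ler0_norm ?subr_le0// lerN2 lerB.
Qed.

Lemma cos_lipschitz a b : `|cos a - cos b| <= `|a - b|.
Proof.
have [c _ ->] := @mean_value _ _ (@is_derive_cos R) b a.
by rewrite normrM normrN ler_piMl// sin_max.
Qed.

Lemma sin_lipschitz a b : `|sin a - sin b| <= `|a - b|.
Proof.
have [c _ ->] := @mean_value _ _ (@is_derive_sin R) b a.
by rewrite normrM ler_piMl// cos_max.
Qed.

Lemma cos_taylor1 x u : `|cos (x + u) - cos x + u * sin x| <= u ^+ 2.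
Proof.
have [c] := @mean_value _ _ (@is_derive_cos R) x (x + u).
rewrite [x + u - x]addrAC subrr add0r => cu ->.
have -> : - sin c * u + u * sin x = - (u * (sin c - sin x)) by ring.
rewrite normrN normrM -real_normK ?num_real// expr2 ler_wpM2l//.
exact: le_trans (sin_lipschitz _ _) cu.
Qed.

Lemma sin_taylor1 x u : `|sin (x + u) - sin x - u * cos x| <= u ^+ 2.
Proof.
have [c] := @mean_value _ _ (@is_derive_sin R) x (x + u).
rewrite [x + u - x]addrAC subrr add0r => cu ->.
have -> : cos c * u - u * cos x = u * (cos c - cos x) by ring.
rewrite normrM -real_normK ?num_real// expr2 ler_wpM2l//.
exact: le_trans (cos_lipschitz _ _) cu.
Qed.

(** Termwise, the tail of the series is dominated on |x| <= M by the tail of the exponential series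
    at [M], so a single truncation index [N], read off from [expR M], works for all such x. *)
Lemma entire_poly_approx (c : nat -> R) f :
  (forall n, `|c n| <= n`!%:R^-1) ->
  (forall x, series (fun n => c n * x ^+ n) @ \oo --> f x) ->
  forall M e, 0 < e -> exists p, forall x, `|x| <= M -> `|f x - p.[x]| <= e.
Proof.
move=> ha hf M e e0.
have [N _ hN] : \forall n \near \oo, `|expR M - series (exp_coeff M) n| <= e.
  have : series (exp_coeff M) @ \oo --> expR M by exact: is_cvg_series_exp_coeff.
  by move/cvgrPdist_le => /(_ e e0).
exists (\poly_(i < N) c i) => x xM.
have -> : (\poly_(i < N) c i).[x] = series (fun n => c n * x ^+ n) N.
  by rewrite horner_poly /series/= big_mkord.
apply: (le_trans _ (hN N (leqnn N))).
have M0 : 0 <= M by exact: le_trans xM.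
have c1 : (fun m => `|series (fun n => c n * x ^+ n) m
   - series (fun n => c n * x ^+ n) N|) @ \oo --> `|f x - series (fun n => c n * x ^+ n) N|.
  by apply: cvg_norm; apply: cvgB (hf x) _; exact: cvg_cst.
have c2 : (fun m => `|series (exp_coeff M) m - series (exp_coeff M) N|) @ \oo -->
   `|expR M - series (exp_coeff M) N|.
  by apply: cvg_norm; apply: cvgB _ (cvg_cst _); exact: is_cvg_series_exp_coeff.
rewrite -(cvg_lim _ c1)// -(cvg_lim _ c2)//.
apply: ler_lim; [exact: cvgP c1|exact: cvgP c2|].
exists N => // m /= Nm; rewrite !sub_series_geq//.
apply: (le_trans (ler_norm_sum _ _ _)); apply: le_trans (ler_norm _).
apply: ler_sum => i _; rewrite normrM normrX mulrC /exp_coeff/=.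
by apply: ler_pM => //; rewrite lerXn2r// nnegrE.
Qed.

Lemma cos_poly_approx M e : 0 < e ->
  exists p, forall x, `|x| <= M -> `|cos x - p.[x]| <= e.
Proof.
apply: (@entire_poly_approx (fun n => (~~ odd n)%:R * (-1) ^+ n./2 * (n`!%:R)^-1)) => [n|x].
  rewrite !normrM normr_nat normrX normrN1 expr1n mulr1 normfV normr_nat.
  by rewrite ler_piMl ?invr_ge0 ?ler0n//; case: odd.
have := @is_cvg_series_cos_coeff R x.
by rewrite cos_coeffE cosE.
Qed.

Lemma sin_poly_approx M e : 0 < e ->
  exists p, forall x, `|x| <= M -> `|sin x - p.[x]| <= e.
Proof.
apply: (@entire_poly_approx (fun n => (odd n)%:R * (-1) ^+ n.-1./2 * (n`!%:R)^-1)) => [n|x].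
  rewrite !normrM normr_nat normrX normrN1 expr1n mulr1 normfV normr_nat.
  by rewrite ler_piMl ?invr_ge0 ?ler0n//; case: odd.
have := @is_cvg_series_sin_coeff R x.
by rewrite sin_coeffE sinE.
Qed.

(** This class of test functions contains polynomials and trigonometric functions, is stable under
    products, and carries the modulus of continuity needed to make [slice_pairing] continuous in
    time. *)
Definition loc_lipschitz f := forall M, exists2 L : R, 0 <= L &
  forall x y, `|x| <= M -> `|y| <= M -> `|f x - f y| <= L * `|x - y|.

Lemma loc_lipschitz_bounded f M : loc_lipschitz f ->
  exists2 B : R, 0 <= B & forall x, `|x| <= M -> `|f x| <= B.
Proof.
move=> /(_ M)[L L0 fL]; exists (`|f 0| + L * `|M|) => [|x xM].
  by rewrite addr_ge0// mulr_ge0.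
have M0 : 0 <= M by exact: le_trans xM.
have := fL x 0 xM; rewrite normr0 subr0 => /(_ M0) h.
rewrite -(subrK (f 0) (f x)) (le_trans (ler_normD _ _))// addrC lerD2l.
by apply: (le_trans h); rewrite ler_wpM2l// (ger0_norm M0).
Qed.

Lemma loc_lipschitz_cst c : loc_lipschitz (fun=> c).
Proof. by move=> M; exists 0 => // x y _ _; rewrite subrr normr0 mul0r. Qed.

Lemma loc_lipschitz_id : loc_lipschitz id.
Proof. by move=> M; exists 1 => // x y _ _; rewrite mul1r. Qed.

Lemma loc_lipschitzD f g : loc_lipschitz f -> loc_lipschitz g ->
  loc_lipschitz (fun x => f x + g x).
Proof.
move=> hf hg M; have [L L0 fL] := hf M; have [L' L'0 gL] := hg M.
exists (L + L') => [|x y xM yM]; first exact: addr_ge0.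
rewrite opprD addrACA mulrDl (le_trans (ler_normD _ _))// lerD//.
  exact: fL.
exact: gL.
Qed.

Lemma loc_lipschitzM f g : loc_lipschitz f -> loc_lipschitz g ->
  loc_lipschitz (fun x => f x * g x).
Proof.
move=> hf hg M; have [L L0 fL] := hf M; have [L' L'0 gL] := hg M.
have [B B0 fB] := loc_lipschitz_bounded M hf.
have [B' B'0 gB] := loc_lipschitz_bounded M hg.
exists (B * L' + L * B') => [|x y xM yM]; first by rewrite addr_ge0 ?mulr_ge0.
have -> : f x * g x - f y * g y = f x * (g x - g y) + (f x - f y) * g y by ring.
rewrite (le_trans (ler_normD _ _))// [leRHS]mulrDl !normrM lerD//.
  by rewrite -mulrA ler_pM// ?fB ?gL.
by rewrite mulrAC ler_pM// ?gB ?fL.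
Qed.

Lemma loc_lipschitzX f n : loc_lipschitz f -> loc_lipschitz (fun x => f x ^+ n).
Proof.
move=> hf; elim: n => [|n IH]; first by under eq_fun do rewrite expr0; exact: loc_lipschitz_cst.
by under eq_fun do rewrite exprS; exact: loc_lipschitzM.
Qed.

Lemma loc_lipschitz_horner p : loc_lipschitz (horner p).
Proof.
elim/poly_ind: p => [|p c IH].
  rewrite (_ : horner 0 = fun=> 0); first exact: loc_lipschitz_cst.
  by apply/funext => x; rewrite horner0.
rewrite (_ : horner _ = fun x => p.[x] * x + c).
  by apply: loc_lipschitzD (loc_lipschitz_cst _); apply: loc_lipschitzM loc_lipschitz_id.
by apply/funext => x; rewrite !hornerE.
Qed.

Lemma loc_lipschitz_cosM k : loc_lipschitz (fun x => cos (k * x)).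
Proof.
move=> M; exists `|k| => // x y _ _.
by rewrite (le_trans (cos_lipschitz _ _))// -mulrBr normrM.
Qed.

Lemma loc_lipschitz_sinM k : loc_lipschitz (fun x => sin (k * x)).
Proof.
move=> M; exists `|k| => // x y _ _.
by rewrite (le_trans (sin_lipschitz _ _))// -mulrBr normrM.
Qed.

(** Plays the role of a finite signed measure carried by [-M, M]: linearity together with continuity
    for the sup norm on that interval. *)
Definition lip_functional M (Lam : (R -> R) -> R) :=
  [/\ forall f g, loc_lipschitz f -> loc_lipschitz g ->
        Lam (fun x => f x + g x) = Lam f + Lam g,
      forall c f, loc_lipschitz f -> Lam (fun x => c * f x) = c * Lam f &
      exists2 K : R, 0 <= K & forall f e, loc_lipschitz f ->
        (forall x, `|x| <= M -> `|f x| <= e) -> `|Lam f| <= K * e].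

(** * From a vanishing frequency band to vanishing moments *)

Section Moments.
Variables (M kmin kmax : R) (Lam : (R -> R) -> R).
Hypothesis LamP : lip_functional M Lam.
Hypothesis M0 : 0 <= M.

Lemma lip_functional_comb c f g : loc_lipschitz f -> loc_lipschitz g ->
  Lam (fun x => c * f x + g x) = c * Lam f + Lam g.
Proof.
have [LD LZ _] := LamP; move=> hf hg; rewrite LD ?LZ//.
by apply: loc_lipschitzM hf; exact: loc_lipschitz_cst.
Qed.

(** The kernel of a functional continuous for the sup norm on [-M, M] is closed for that norm. *)
Lemma lip_functional_closed f : loc_lipschitz f ->
  (forall e, 0 < e -> exists g, [/\ loc_lipschitz g, Lam g = 0 &
     forall x, `|x| <= M -> `|f x - g x| <= e]) ->
  Lam f = 0.
Proof.
move=> hf H; have [_ _ [K K0 LamK]] := LamP.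
apply/eqP; rewrite -normr_le0; apply/ler_addgt0Pr => e e0; rewrite add0r.
(* [K] may be 0, so the tolerance is divided by [K + 1]. *)
have K1 : 0 < K + 1 by rewrite ltr_wpDl.
have [g [hg Lg fg]] := H (e / (K + 1)) (divr_gt0 e0 K1).
have hmg : loc_lipschitz (fun x => -1 * g x + f x).
  apply: loc_lipschitzD hf; apply: loc_lipschitzM hg; exact: loc_lipschitz_cst.
have := lip_functional_comb (-1) hg hf; rewrite Lg mulr0 add0r => <-.
apply: (le_trans (LamK _ (e / (K + 1)) hmg _)) => [x xM|].
  by rewrite mulN1r addrC fg.
by rewrite mulrCA ler_piMr ?(ltW e0)// ler_pdivrMr// mul1r lerDl.
Qed.

Hypothesis hcos : forall k, kmin <= k <= kmax -> Lam (fun x => cos (k * x)) = 0.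
Hypothesis hsin : forall k, kmin <= k <= kmax -> Lam (fun x => sin (k * x)) = 0.

(* Differentiating the vanishing transforms [n] times in [k] *)
Lemma modulated_moments n k : kmin < k < kmax ->
  Lam (fun x => x ^+ n * cos (k * x)) = 0 /\ Lam (fun x => x ^+ n * sin (k * x)) = 0.
Proof.
have lX m : loc_lipschitz (fun x => x ^+ m) by apply: loc_lipschitzX loc_lipschitz_id.
have lC m j : loc_lipschitz (fun x => x ^+ m * cos (j * x)).
  by apply: loc_lipschitzM (loc_lipschitz_cosM _).
have lS m j : loc_lipschitz (fun x => x ^+ m * sin (j * x)).
  by apply: loc_lipschitzM (loc_lipschitz_sinM _).
elim: n k => [|n IH] k /andP[k1 k2].
  have kk : kmin <= k <= kmax by rewrite !ltW.
  split; [rewrite -[RHS](hcos kk)|rewrite -[RHS](hsin kk)];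
  by congr Lam; apply/funext => x; rewrite expr0 mul1r.
(* Only forward differences in [k] are taken, so the step must merely stay below [kmax];
   [M ^+ n.+2 * h] is the error of the difference quotient of the n-th modulated moment. *)
have step e : 0 < e -> exists h, [/\ 0 < h, kmin < k + h < kmax & M ^+ n.+2 * h <= e].
  move=> e0; have P0 : 0 < M ^+ n.+2 + 1 by rewrite ltr_wpDl// exprn_ge0.
  exists (Num.min ((kmax - k) / 2) (e / (M ^+ n.+2 + 1))).
  set h := Num.min _ _.
  have h0 : 0 < h by rewrite lt_min !divr_gt0// subr_gt0.
  have h1 : h <= (kmax - k) / 2 by rewrite ge_min lexx.
  have h2 : h <= e / (M ^+ n.+2 + 1) by rewrite ge_min lexx orbT.
  split => //; first by apply/andP; split; lra.
  rewrite ler_pdivlMr// in h2; apply: le_trans h2.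
  by rewrite mulrC ler_wpM2l ?(ltW h0)// lerDl.
(* Here [d] is an increment of sin or cos with first-order part [- h * x * c]; dividing the
   quadratic remainder by [h] and multiplying by [x ^+ n] leaves at most [M ^+ n.+2 * h]. *)
have key (x c d h E : R) : `|x| <= M -> 0 < h -> `|d + h * x * c| <= (h * x) ^+ 2 ->
    M ^+ n.+2 * h <= E -> `|x ^+ n.+1 * c + h^-1 * (x ^+ n * d)| <= E.
  move=> xM h0 dh; apply: le_trans.
  have -> : x ^+ n.+1 * c + h^-1 * (x ^+ n * d) = h^-1 * (x ^+ n * (d + h * x * c)).
    by rewrite exprS; field; rewrite gt_eqF.
  rewrite normrM normfV (gtr0_norm h0) ler_pdivrMl// normrM normrX.
  have -> : h * (M ^+ n.+2 * h) = M ^+ n * (h * M) ^+ 2 by rewrite !exprS; ring.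
  apply: ler_pM; rewrite ?exprn_ge0//; first by rewrite lerXn2r// nnegrE.
  apply: (le_trans dh); rewrite !exprMn ler_wpM2l ?sqr_ge0//.
  by rewrite -real_normK ?num_real// lerXn2r// nnegrE.
have [Ck Sk] := IH k (introT andP (conj k1 k2)).
split; apply: lip_functional_closed => // e e0; have [h [h0 /IH[Ch Sh] hM]] := step e e0.
(* The difference quotient in [k] of the n-th sine moment is annihilated by the induction hypothesis
   at [k] and [k + h], and tends uniformly to the next cosine moment. *)
- exists (fun x => h^-1 * (x ^+ n * sin ((k + h) * x)) + - h^-1 * (x ^+ n * sin (k * x))).
  have l1 : loc_lipschitz (fun x => - h^-1 * (x ^+ n * sin (k * x))).
    by apply: loc_lipschitzM (lS _ _); exact: loc_lipschitz_cst.
  split.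
  + by apply: loc_lipschitzD l1; apply: loc_lipschitzM (lS _ _); exact: loc_lipschitz_cst.
  + rewrite lip_functional_comb// Sh mulr0 add0r.
    by have [_ LZ _] := LamP; rewrite LZ// Sk mulr0.
  + move=> x xM.
    have := key x (- cos (k * x)) (sin (k * x + h * x) - sin (k * x)) h e xM h0.
    rewrite mulrN => /(_ (sin_taylor1 _ _) hM).
    rewrite -normrN; congr (`|_| <= _); rewrite mulrDl; ring.
- exists (fun x => - h^-1 * (x ^+ n * cos ((k + h) * x)) + h^-1 * (x ^+ n * cos (k * x))).
  have l1 : loc_lipschitz (fun x => h^-1 * (x ^+ n * cos (k * x))).
    by apply: loc_lipschitzM (lC _ _); exact: loc_lipschitz_cst.
  split.
  + by apply: loc_lipschitzD l1; apply: loc_lipschitzM (lC _ _); exact: loc_lipschitz_cst.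
  + rewrite lip_functional_comb// Ch mulr0 add0r.
    by have [_ LZ _] := LamP; rewrite LZ// Ck mulr0.
  + move=> x xM.
    have := key x (sin (k * x)) (cos (k * x + h * x) - cos (k * x)) h e xM h0.
    move=> /(_ (cos_taylor1 _ _) hM).
    congr (`|_| <= _); rewrite mulrDl; ring.
Qed.

Lemma modulated_horner p k : kmin < k < kmax ->
  Lam (fun x => p.[x] * cos (k * x)) = 0 /\ Lam (fun x => p.[x] * sin (k * x)) = 0.
Proof.
move=> kk; have lX m : loc_lipschitz (fun x => x ^+ m) by apply: loc_lipschitzX loc_lipschitz_id.
(* The extra factor [x ^+ n] absorbs the 'X produced by the induction on [p]. *)
suff H n : Lam (fun x => x ^+ n * p.[x] * cos (k * x)) = 0 /\
           Lam (fun x => x ^+ n * p.[x] * sin (k * x)) = 0.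
  have [h1 h2] := H 0%N; rewrite -[X in _ = X /\ _]h1 -[X in _ /\ _ = X]h2.
  by split; congr Lam; apply/funext => x; rewrite expr0 mul1r.
elim/poly_ind: p n => [|p c IH] n.
  have [_ LZ _] := LamP.
  have Z : Lam (fun x => 0 * 0) = 0 by rewrite LZ ?mul0r//; exact: loc_lipschitz_cst.
  by split; rewrite -[RHS]Z; congr Lam; apply/funext => x; rewrite horner0 mulr0 !mul0r.
have [C1 S1] := IH n.+1; have [C2 S2] := modulated_moments n kk.
split.
- rewrite (_ : (fun x => _) = fun x => c * (x ^+ n * cos (k * x)) + x ^+ n.+1 * p.[x] * cos (k * x)).
    rewrite lip_functional_comb ?C1 ?C2 ?mulr0 ?addr0//.
      by apply: loc_lipschitzM (loc_lipschitz_cosM _).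
    apply: loc_lipschitzM (loc_lipschitz_cosM _).
    by apply: loc_lipschitzM (lX _) (loc_lipschitz_horner _).
  by apply/funext => x; rewrite hornerMXaddC exprS; ring.
- rewrite (_ : (fun x => _) = fun x => c * (x ^+ n * sin (k * x)) + x ^+ n.+1 * p.[x] * sin (k * x)).
    rewrite lip_functional_comb ?S1 ?S2 ?mulr0 ?addr0//.
      by apply: loc_lipschitzM (loc_lipschitz_sinM _).
    apply: loc_lipschitzM (loc_lipschitz_sinM _).
    by apply: loc_lipschitzM (lX _) (loc_lipschitz_horner _).
  by apply/funext => x; rewrite hornerMXaddC exprS; ring.
Qed.

(* The modulation is removed by [cos ^ 2 + sin ^ 2 = 1], one factor of each square being replaced by a polynomial. *)
Lemma moments_vanish p : kmin < kmax -> Lam (horner p) = 0.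
Proof.
move=> kk; pose k := (kmin + kmax) / 2.
have kb : kmin < k < kmax by rewrite /k; apply/andP; split; lra.
have lp := loc_lipschitz_horner p.
apply: lip_functional_closed => // e e0.
have [B B0 pB] := loc_lipschitz_bounded M lp.
(* The cosine and sine errors each enter multiplied by |p(x)| <= B, hence the factor [2 * B]. *)
have d0 : 0 < e / (2 * B + 1) by rewrite divr_gt0// ltr_wpDl// mulr_ge0.
have [q1 H1] := cos_poly_approx (`|k| * M) d0.
have [q2 H2] := sin_poly_approx (`|k| * M) d0.
pose r1 := p * (q1 \Po (k *: 'X)); pose r2 := p * (q2 \Po (k *: 'X)).
have l2 : loc_lipschitz (fun x => r2.[x] * sin (k * x)).
  by apply: loc_lipschitzM (loc_lipschitz_horner _) (loc_lipschitz_sinM _).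
have l1 : loc_lipschitz (fun x => r1.[x] * cos (k * x)).
  by apply: loc_lipschitzM (loc_lipschitz_horner _) (loc_lipschitz_cosM _).
exists (fun x => r1.[x] * cos (k * x) + r2.[x] * sin (k * x)); split.
- exact: loc_lipschitzD.
- have [LD _ _] := LamP; rewrite LD//.
  by rewrite (modulated_horner r1 kb).1 (modulated_horner r2 kb).2 addr0.
- move=> x xM; rewrite /r1 /r2 !hornerM !horner_comp !hornerZ !hornerX.
  have kx : `|k * x| <= `|k| * M by rewrite normrM ler_wpM2l.
  have -> : p.[x] - (p.[x] * q1.[k * x] * cos (k * x) + p.[x] * q2.[k * x] * sin (k * x))
      = p.[x] * ((cos (k * x) - q1.[k * x]) * cos (k * x)
                + (sin (k * x) - q2.[k * x]) * sin (k * x)).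
    by rewrite -[X in X - _]mulr1 -(cos2Dsin2 (k * x)); ring.
  rewrite normrM; apply: (@le_trans _ _ (B * (e / (2 * B + 1) + e / (2 * B + 1)))).
    apply: ler_pM => //; first exact: pB.
    apply: (le_trans (ler_normD _ _)); rewrite !normrM.
    apply: lerD; rewrite -[leRHS]mulr1; apply: ler_pM => //.
    + exact: H1. + exact: cos_max. + exact: H2. + exact: sin_max.
  have b1 : 0 < 2 * B + 1 by rewrite ltr_wpDl// mulr_ge0.
  rewrite (_ : B * _ = 2 * B * e / (2 * B + 1)); last by field; rewrite gt_eqF.
  by rewrite ler_pdivrMr// mulrDr mulr1 mulrC lerDl ltW.
Qed.

End Moments.
End Fourier.

(** * Convex hulls and half-spaces *)

Section ConvexGeometry.
Context {R : realType}.
Implicit Types (C D E : set (pt R)) (x y z v : pt R).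

Definition normsq3 x : R := dot3 x x.

Lemma open3P D : open D <-> forall y, D y -> exists2 r : R, 0 < r & forall z,
  `|c1 z - c1 y| < r -> `|c2 z - c2 y| < r -> `|c3 z - c3 y| < r -> D z.
Proof.
rewrite openE; split=> [oD y /oD/nbhs_ballP[r /= r0 rD]|h y /h[r r0 rD]].
  exists r => // z h1 h2 h3; apply: rD.
  by do 2?split; rewrite /ball/= distrC.
apply/nbhs_ballP; exists r => // z [[/= h1 h2] h3].
by apply: rD; rewrite distrC.
Qed.

Lemma mkpt_eta y : mkpt (c1 y) (c2 y) (c3 y) = y.
Proof. by case: y => [[]]. Qed.

Lemma convex_hull3_convex D : convex3 (convex_hull3 D).
Proof.
move=> x y l Dx Dy l01 C cC DC.
exact: (cC _ _ _ (Dx _ cC DC) (Dy _ cC DC) l01).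
Qed.

Lemma sub_convex_hull3 D : D `<=` convex_hull3 D.
Proof. by move=> x Dx C _; exact. Qed.

Lemma convex_hull3_sub D E : D `<=` convex_hull3 E -> convex_hull3 D `<=` convex_hull3 E.
Proof. by move=> DE x Dx; apply: (Dx (convex_hull3 E)) => //; exact: convex_hull3_convex. Qed.

Lemma bounded_convex_hull3 D : bounded3 D -> bounded3 (convex_hull3 D).
Proof.
move=> [M DM]; exists M => y Dy.
apply: (Dy [set y | `|c1 y| <= M /\ `|c2 y| <= M /\ `|c3 y| <= M]) => // x z l [x1 [x2 x3]] [z1 [z2 z3]] /andP[l0 l1].
have aux (a b : R) : `|a| <= M -> `|b| <= M -> `|l * a + (1 - l) * b| <= M.
  rewrite !ler_norml => /andP[a1 a2] /andP[b1 b2]; apply/andP; split; nra.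
by split; [|split]; exact: aux.
Qed.

(* An approximate nearest point [z0] of [C] to [y] already gives a separating direction [y - z0]. *)
Lemma convex3_separation C y (d : R) : convex3 C -> bounded3 C -> C !=set0 -> 0 < d ->
  (forall z, C z -> d <= normsq3 (sub3 z y)) ->
  exists v (c : R), (forall z, C z -> dot3 v z <= c) /\ c < dot3 v y.
Proof.
move=> cC [M CM] [p Cp] d0 dC.
pose A := [set normsq3 (sub3 z y) | z in C].
have hA : has_inf A.
  by split; [exists (normsq3 (sub3 p y)), p|exists d => _ [z Cz <-]; exact: dC].
(* Bound on the squared diameter of [C]: each of the three coordinates varies by at most [2 * M]. *)
pose K := 12 * M ^+ 2.
have K0 : 0 <= K by rewrite /K mulr_ge0// sqr_ge0.
(* With [z0] minimal up to [l ^+ 2], moving a fraction [l] from [z0] towards z shows that [dot3 v]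
   grows by at most l (1 + K) / 2 <= d / 2 from [z0] to z, while it grows by at least [d] from [z0]
   to [y]. *)
pose l := Num.min 1 (d / (1 + K)).
have K1 : 0 < 1 + K by lra.
have l0 : 0 < l by rewrite lt_min ltr01 divr_gt0.
have l1 : l <= 1 by rewrite ge_min lexx.
have lK : l * (1 + K) <= d by rewrite -ler_pdivlMr// ge_min lexx orbT.
have [_ [z0 Cz0 <-] z0A] := inf_adherent (exprn_gt0 2 l0) hA.
pose v := sub3 y z0; exists v, (dot3 v z0 + l * (1 + K) / 2); split; last first.
  have -> : dot3 v y = dot3 v z0 + normsq3 (sub3 z0 y).
    by rewrite /v /normsq3 /dot3 /sub3 /c1 /c2 /c3 /=; ring.
  by have := dC _ Cz0; lra.
move=> z Cz; have lA : inf A <= normsq3 (sub3 (mkpt (l * c1 z + (1 - l) * c1 z0)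
    (l * c2 z + (1 - l) * c2 z0) (l * c3 z + (1 - l) * c3 z0)) y).
  by apply: ge_inf; [exact: hA.2|eexists; [|reflexivity]; apply: cC; rewrite // (ltW l0)].
have zK : normsq3 (sub3 z z0) <= K.
  have [m1 [m2 m3]] := CM z Cz; have [n1 [n2 n3]] := CM z0 Cz0.
  have aux (a b : R) : `|a| <= M -> `|b| <= M -> (a - b) * (a - b) <= 4 * M ^+ 2.
    by rewrite !ler_norml => /andP[? ?] /andP[? ?]; nra.
  rewrite /normsq3 /dot3 /sub3 /= /K.
  have := aux _ _ m1 n1; have := aux _ _ m2 n2; have := aux _ _ m3 n3.
  rewrite /c1 /c2 /c3/=; lra.
have E : normsq3 (sub3 (mkpt (l * c1 z + (1 - l) * c1 z0) (l * c2 z + (1 - l) * c2 z0)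
    (l * c3 z + (1 - l) * c3 z0)) y) =
    normsq3 (sub3 z0 y) - 2 * l * (dot3 v z - dot3 v z0) + l ^+ 2 * normsq3 (sub3 z z0).
  by rewrite /v /normsq3 /dot3 /sub3 /c1 /c2 /c3 /=; ring.
rewrite E in lA; have lK2 : l ^+ 2 * normsq3 (sub3 z z0) <= l ^+ 2 * K.
  by rewrite ler_wpM2l// sqr_ge0.
have : l * (dot3 v z - dot3 v z0) <= l * (l * (1 + K) / 2) by lra.
by rewrite ler_pM2l//; lra.
Qed.

(** Separation needs a point at positive distance from the hull. So [y] is pushed slightly away from
    a point [p] of [E] to a point [q] still in [D]. If the hull comes close to [q], the room around
    [p] lets [y] be written as a convex combination; otherwise [q] is strictly separated from the
    hull, against the half-space hypothesis. *)
Lemma sub_convex_hull3_of_halfspaces D E : open D -> open E -> E !=set0 -> bounded3 E ->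
  (forall v (c : R), on_sphere2 v -> (forall z, E z -> dot3 v z <= c) ->
     forall y, D y -> dot3 v y <= c) ->
  D `<=` convex_hull3 E.
Proof.
move=> /open3P oD /open3P oE [p Ep] bE H y Dy.
have [r r0 rE] := oE p Ep; have [s s0 sD] := oD y Dy.
pose w := sub3 y p; pose W := 1 + `|c1 w| + `|c2 w| + `|c3 w|.
have W0 : 0 < W by rewrite /W -!addrA ltr_pwDl// !addr_ge0.
pose e := s / W; have e0 : 0 < e by rewrite divr_gt0.
pose q := mkpt (c1 y + e * c1 w) (c2 y + e * c2 w) (c3 y + e * c3 w).
have eW (a : R) : `|a| < W -> `|e * a| < s.
  by move=> aW; rewrite normrM (gtr0_norm e0) /e mulrAC ltr_pdivrMr// ltr_pM2l.
have w1 := normr_ge0 (c1 w); have w2 := normr_ge0 (c2 w); have w3 := normr_ge0 (c3 w).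
have Dq : D q.
  by apply: sD; rewrite /q /= addrC addKr; apply: eW; rewrite /W; lra.
have er0 : 0 < e * r by rewrite mulr_gt0.
have [[q' [Cq' near]]|far] := pselect (exists q', convex_hull3 E q' /\ normsq3 (sub3 q' q) < (e * r) ^+ 2).
  have aux (a b c : R) : a * a + b * b + c * c < (e * r) ^+ 2 ->
      [/\ `|- a / e| < r, `|- b / e| < r & `|- c / e| < r].
    move=> abc.
    have aux' (u : R) : u * u < (e * r) ^+ 2 -> `|- u / e| < r.
      move=> uu; rewrite normrM normrN normfV (gtr0_norm e0) ltr_pdivrMr// mulrC.
      by rewrite -(@ltr_pXn2r _ 2)// ?nnegrE ?(ltW er0)// real_normK ?num_real// expr2.
    by split; apply: aux'; apply: le_lt_trans abc; rewrite -!expr2;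
      have := sqr_ge0 a; have := sqr_ge0 b; have := sqr_ge0 c; lra.
  have [n1 n2 n3] := aux _ _ _ near.
  (* Chosen so that y = (q' + e p') / (1 + e): the error q' - q is compensated at [p], magnified by
     1 / e, which is why closeness [e * r] was required. *)
  pose p' := mkpt (c1 p - c1 (sub3 q' q) / e) (c2 p - c2 (sub3 q' q) / e) (c3 p - c3 (sub3 q' q) / e).
  have Ep' : E p'.
    by apply: rE; rewrite /p' /= addrC addKr -mulNr.
  have l01 : 0 <= (1 + e)^-1 <= 1.
    by rewrite invr_ge0 invf_le1; lra.
  have := @convex_hull3_convex E q' p' (1 + e)^-1 Cq' (sub_convex_hull3 Ep') l01.
  have e1 : 1 + e != 0 by rewrite gt_eqF// ltr_pwDl// ltW.
  have e2 : e != 0 by rewrite gt_eqF.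
  rewrite -[X in _ -> convex_hull3 E X]mkpt_eta; congr (convex_hull3 E (mkpt _ _ _));
    by rewrite /p' /q /w /mkpt /sub3 /c1 /c2 /c3 /=; field; rewrite e1 e2.
have bC := bounded_convex_hull3 bE.
have farq z : convex_hull3 E z -> (e * r) ^+ 2 <= normsq3 (sub3 z q).
  by move=> Cz; rewrite leNgt; apply/negP => zq; apply: far; exists z.
have [|v [c [vc cq]]] := convex3_separation (@convex_hull3_convex E) bC _ (exprn_gt0 2 er0) farq.
  by exists p; exact: sub_convex_hull3.
pose N := Num.sqrt (dot3 v v).
(* A zero [v] could not separate [q] from [p]; hence [v] can be normalised to the unit sphere. *)
have vv0 : 0 < dot3 v v.
  rewrite lt_neqAle eq_sym; apply/andP; split; last first.
    by rewrite /dot3 -!expr2 !addr_ge0// sqr_ge0.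
  apply/negP => /eqP vv.
  have : dot3 v q - dot3 v p <= 0.
    have v1 : c1 v = 0.
      apply/eqP; rewrite -sqrf_eq0 eq_le sqr_ge0 andbT -vv /dot3 -!expr2.
      by have := sqr_ge0 (c2 v); have := sqr_ge0 (c3 v); lra.
    have v2 : c2 v = 0.
      apply/eqP; rewrite -sqrf_eq0 eq_le sqr_ge0 andbT -vv /dot3 -!expr2.
      by have := sqr_ge0 (c1 v); have := sqr_ge0 (c3 v); lra.
    have v3 : c3 v = 0.
      apply/eqP; rewrite -sqrf_eq0 eq_le sqr_ge0 andbT -vv /dot3 -!expr2.
      by have := sqr_ge0 (c1 v); have := sqr_ge0 (c2 v); lra.
    by rewrite /dot3 v1 v2 v3; lra.
  by have := vc p (sub_convex_hull3 Ep); lra.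
have N0 : 0 < N by rewrite sqrtr_gt0.
pose u := mkpt (c1 v / N) (c2 v / N) (c3 v / N).
have uE z : dot3 u z = dot3 v z / N by rewrite /u /dot3 /c1 /c2 /c3 /mkpt /=; ring.
suff : dot3 u q <= c / N by rewrite uE ler_pdivrMr// divfK ?gt_eqF// leNgt cq.
apply: H Dq => [|z Ez].
  rewrite /on_sphere2 uE (_ : dot3 v u = dot3 v v / N); last first.
    by rewrite /u /dot3 /c1 /c2 /c3 /mkpt /=; ring.
  by rewrite -mulrA -invfM -expr2 sqr_sqrtr ?ltW// mulfV ?gt_eqF.
by rewrite uE ler_pM2r ?invr_gt0//; apply: vc; exact: sub_convex_hull3.
Qed.

End ConvexGeometry.

(** * Volume and almost-everywhere bounds *)

Section AlmostEverywhere.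
Context d (T : measurableType d) (R : realType) (mu : {measure set T -> \bar R}).
Variable D : set T.
Hypothesis mD : measurable D.

Lemma ae_impl (P Q : T -> Prop) : {ae mu, forall x, D x -> P x} ->
  (forall x, D x -> P x -> Q x) -> {ae mu, forall x, D x -> Q x}.
Proof. by move=> aP PQ; apply: filterS aP => x Px Dx; exact/PQ/Px. Qed.

Lemma ae_impl2 (P1 P2 Q : T -> Prop) : {ae mu, forall x, D x -> P1 x} ->
  {ae mu, forall x, D x -> P2 x} ->
  (forall x, D x -> P1 x -> P2 x -> Q x) -> {ae mu, forall x, D x -> Q x}.
Proof.
by move=> aP1 aP2 PQ; apply: filterS2 aP1 aP2 => x Px1 Px2 Dx; apply: PQ; [|exact: Px1|exact: Px2].
Qed.

Lemma ae_bounded_integrable (f : T -> R) (M : R) : (mu D < +oo)%E ->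
  measurable_fun D f -> {ae mu, forall x, D x -> `|f x| <= M} ->
  mu.-integrable D (EFin \o f).
Proof.
move=> muD mf fM; apply/integrableP; split; first exact/measurable_EFinP.
apply: (@le_lt_trans _ _ (\int[mu]_(x in D) (`|M|%:E))%E).
  apply: ae_ge0_le_integral => //=.
  - by apply/measurable_EFinP; exact: measurableT_comp.
  - apply: filterS fM => x fx Dx; rewrite lee_fin.
    exact: le_trans (fx Dx) (ler_norm _).
by rewrite integral_cst// lte_mul_pinfty.
Qed.

Lemma cst_integrable (k : R) : (mu D < +oo)%E -> mu.-integrable D (EFin \o (fun=> k)).
Proof.
move=> muD; apply: (@ae_bounded_integrable _ `|k|) => //.
by apply: aeW => x Dx.
Qed.

Lemma cst_indic_integrable (E : set T) (k : R) : (mu D < +oo)%E -> measurable E ->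
  mu.-integrable D (EFin \o (fun x => k * \1_E x)).
Proof.
move=> muD mE; apply: (@ae_bounded_integrable _ `|k|) => //.
  apply: measurable_funM; [exact: measurable_cst|apply: measurable_funTS].
  exact: measurable_indic.
apply: aeW => x _; rewrite normrM ler_piMr// indicE.
by case: (_ \in _); rewrite ?normr1 ?normr0.
Qed.

Lemma EFin_integrableB (f g : T -> R) :
  mu.-integrable D (EFin \o f) -> mu.-integrable D (EFin \o g) ->
  mu.-integrable D (EFin \o (fun x => f x - g x)).
Proof. exact: integrableB. Qed.

Lemma ae_le_Rintegral (f g : T -> R) :
  mu.-integrable D (EFin \o f) -> mu.-integrable D (EFin \o g) ->
  {ae mu, forall x, D x -> f x <= g x} ->
  \int[mu]_(x in D) f x <= \int[mu]_(x in D) g x.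
Proof.
move=> If Ig fg; rewrite -subr_ge0 -RintegralB//.
(* [h] equals [g - f] almost everywhere and is nonnegative everywhere, as [Rintegral_ge0]
   demands. *)
pose h x := Num.max 0 (g x - f x).
have mgf : measurable_fun D (fun x => g x - f x).
  apply: measurable_funB; apply/measurable_EFinP.
    by case/integrableP : Ig.
  by case/integrableP : If.
rewrite [X in 0 <= X](_ : _ = \int[mu]_(x in D) h x).
  by apply: Rintegral_ge0 => x _; rewrite le_max lexx.
congr fine; apply: ae_eq_integral => //.
- exact/measurable_EFinP.
- by apply/measurable_EFinP; apply: measurable_maxr => //; exact: measurable_cst.
- apply: filterS fg => x fg Dx /=; congr (_%:E).
  by rewrite /h; apply/esym/max_idPr; rewrite subr_ge0 fg.
Qed.

Lemma Rintegral_cst_indic (E : set T) (k : R) : measurable E -> E `<=` D ->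
  \int[mu]_(x in D) (k * \1_E x) = k * fine (mu E).
Proof.
move=> mE ED.
transitivity (\int[mu]_(x in D `&` E) k).
  rewrite Rintegral_mkcondr; apply: eq_Rintegral => x _.
  by rewrite /patch indicE; case: ifP => _; rewrite ?mulr1 ?mulr0.
by rewrite Rintegral_cst ?setIidr//; exact: measurableI.
Qed.

End AlmostEverywhere.

(** * Measurability and Lebesgue measure of boxes and open sets in space *)

Section Volume.
Context {R : realType}.
Implicit Types (D : set (pt R)).

(* [vol3] is a bare set function; [vol] is the same function with its measure structure. *)
Definition vol : {measure set (measurableTypeR R * measurableTypeR R * measurableTypeR R)%type -> \bar R} :=
  ((@lebesgue_measure R \x @lebesgue_measure R) \x @lebesgue_measure R)%E.

Lemma volE : @vol3 R = vol. Proof. by []. Qed.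

Definition box (y : pt R) (r : R) : set (pt R) :=
  (`]c1 y - r, c1 y + r[ `*` `]c2 y - r, c2 y + r[) `*` `]c3 y - r, c3 y + r[.

Lemma boxP y r z : box y r z <->
  [/\ `|c1 z - c1 y| < r, `|c2 z - c2 y| < r & `|c3 z - c3 y| < r].
Proof.
rewrite /box /= !in_itv/= -!ltr_distl.
by split=> [[[? ?] ?]|[? ? ?]].
Qed.

Lemma measurable_box y r : measurable (box y r).
Proof. by apply: measurableX; [apply: measurableX|]; exact: measurable_itv. Qed.

Lemma vol3_box y r : 0 < r -> vol3 (box y r) = ((2 * r) ^+ 3)%:E.
Proof.
move=> r0; have L (a : R) : lebesgue_measure (`]a - r, a + r[%classic : set R) = (2 * r)%:E.
  rewrite lebesgue_measure_itv/= lte_fin ltrD2l gtrN//.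
  by rewrite -EFinB; congr (_%:E); ring.
have m (a : R) : measurable (`]a - r, a + r[%classic : set (measurableTypeR R)).
  exact: measurable_itv.
rewrite volE /box (_ : (2 * r) ^+ 3 = 2 * r * (2 * r) * (2 * r)); last by ring.
apply: (etrans (@product_measure1E _ _ _ _ _ _ _ _ _ (measurableX (m _) (m _)) (m _))).
rewrite EFinM; congr (_ * _)%E; last exact: L.
apply: (etrans (@product_measure1E _ _ _ _ _ _ _ _ _ (m _) (m _))).
by rewrite EFinM; congr (_ * _)%E; exact: L.
Qed.

(** The sigma-algebra is the product one, so [D] is exhibited as a countable union of boxes with
    rational centre and radius; a box not contained in [D] is replaced by the empty set. *)
Lemma open_measurable3 D : open D -> measurable D.
Proof.
move=> /open3P oD.
pose F (i : rat * rat * rat * rat) : set (pt R) :=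
  let y := mkpt (ratr i.1.1.1) (ratr i.1.1.2) (ratr i.1.2) in
  if `[< box y (ratr i.2) `<=` D >] then box y (ratr i.2) else set0.
rewrite (_ : D = \bigcup_i F i).
  apply: countable_bigcupT_measurable => [|i]; first exact: countableP.
  rewrite /F; case: ifP => _ //.
  exact: measurable_box.
apply/seteqP; split=> [y Dy|y [i _]]; last first.
  by rewrite /F; case: asboolP => // + yb; exact.
have [r r0 rD] := oD y Dy.
(* A box of radius s < r / 2 containing [y] has all its points within 2 s < r of [y], coordinate by
   coordinate. *)
have r2 : 0 < r / 2 by rewrite divr_gt0.
have [s] := rat_in_itvoo r2; rewrite in_itv/= => /andP[s0 sr].
have Q (a : R) : exists q : rat, `|a - ratr q| < ratr s.
  have : a - ratr s < a + ratr s by rewrite ltrD2l gtrN.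
  move=> /rat_in_itvoo[q]; rewrite in_itv/= -ltr_distlC => h; exists q.
  exact: h.
have [q1 Q1] := Q (c1 y); have [q2 Q2] := Q (c2 y); have [q3 Q3] := Q (c3 y).
exists (q1, q2, q3, s) => //; rewrite /F /=.
case: asboolP => [_|[]]; first by apply/boxP.
move=> z /boxP[/= z1 z2 z3].
have tr (a b c : R) : `|a - b| < ratr s -> `|c - b| < ratr s -> `|a - c| < r.
  by move=> h1 h2; rewrite (le_lt_trans (ler_distD b _ _))// [in X in _ + X]distrC; lra.
apply: rD; [exact: tr z1 Q1|exact: tr z2 Q2|exact: tr z3 Q3].
Qed.

Lemma vol3_bounded_lty D : open D -> bounded3 D -> (vol3 D < +oo)%E.
Proof.
move=> oD [M DM]; pose r := `|M| + 1.
have r0 : 0 < r by rewrite ltr_wpDl.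
apply: (@le_lt_trans _ _ (vol3 (box (mkpt 0 0 0) r))); last by rewrite vol3_box// ltry.
rewrite volE; apply: le_measure; rewrite ?inE; [exact: open_measurable3|exact: measurable_box|].
move=> y /DM[y1 [y2 y3]]; apply/boxP; rewrite /= !subr0.
have Mr : M < r by rewrite (le_lt_trans (ler_norm _))// ltrDl.
by split; apply: le_lt_trans Mr.
Qed.

Lemma vol3_open_gt0 D : open D -> D !=set0 -> (0 < vol3 D)%E.
Proof.
move=> oD [y Dy]; have [r r0 rD] := (open3P D).1 oD y Dy.
apply: (@lt_le_trans _ _ (vol3 (box y r))).
  by rewrite vol3_box// lte_fin exprn_gt0// mulr_gt0.
rewrite volE; apply: le_measure; rewrite ?inE; [exact: measurable_box|exact: open_measurable3|].
by move=> z /boxP[]; exact: rD.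
Qed.

End Volume.

(** * The pairing of a source with functions of the delay *)

Section SourcePairing.
Context {R : realType}.
Implicit Types (f g : R -> R).

Lemma loc_lipschitz_continuous f : loc_lipschitz f -> continuous f.
Proof.
move=> hf x; apply/cvgrPdist_le => e e0.
have [L L0 fL] := hf (`|x| + 1).
have d0 : 0 < Num.min 1 (e / (L + 1)).
  by rewrite lt_min ltr01 divr_gt0// ltr_wpDl.
near=> y.
have : `|x - y| < Num.min 1 (e / (L + 1)) by near: y; exact: (@cvgr_dist_lt _ _ _ _ _ id).
rewrite lt_min => /andP[y1 ye].
apply: (le_trans (fL _ _ _ _)).
- by rewrite lerDl.
- rewrite -(subrK x y) addrC (le_trans (ler_normD _ _))// lerD2l distrC.
  exact: ltW.
- apply: (@le_trans _ _ ((L + 1) * `|x - y|)); first by rewrite ler_wpM2r// lerDl.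
  by rewrite mulrC -ler_pdivlMr ?ltr_wpDl// ltW.
Unshelve. all: by end_near. Qed.

Definition slice_pairing (D : set (pt R)) (S : pt R -> R -> R) (xh : pt R) f (t : R) : R :=
  Rintegral (@vol3 R) D (fun y => f (t - dot3 xh y) * S y t).

(** For [f] equal to cos (k x) or sin (k x) this unfolds to a component of [farfield] without its
    constant factor. *)
Definition source_pairing (D : set (pt R)) (S : pt R -> R -> R) (a b : R) (xh : pt R) f : R :=
  Rintegral (@lebesgue_measure R) `[a, b] (slice_pairing D S xh f).

Lemma measurable_dot3 (xh : pt R) : measurable_fun [set: pt R] (dot3 xh).
Proof.
have m1 : measurable_fun [set: pt R] (@c1 R) by exact: measurableT_comp measurable_fst.
have m2 : measurable_fun [set: pt R] (@c2 R) by exact: measurableT_comp measurable_fst.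
have m3 : measurable_fun [set: pt R] (@c3 R) by exact: measurable_snd.
by apply: measurable_funD; [apply: measurable_funD|]; apply: measurable_funM => //;
  exact: measurable_cst.
Qed.

Variables (D : set (pt R)) (S : pt R -> R -> R) (a b : R) (xh : pt R).
Hypothesis HS : source_assumptions D S a b.

Local Notation slice := (slice_pairing D S xh).
Local Notation pair := (source_pairing D S a b xh).

Lemma source_open : open D. Proof. by have [[[]]] := HS. Qed.
Lemma source_nonempty : D !=set0. Proof. by have [[[]]] := HS. Qed.
Lemma source_bounded : bounded3 D. Proof. by have [[[]]] := HS. Qed.
Lemma source_time : 0 <= a < b. Proof. by have [] := HS. Qed.

Let mD : measurable (D : set (measurableTypeR R * measurableTypeR R * measurableTypeR R)%type) := open_measurable3 source_open.
Let Doo : (vol D < +oo)%E := vol3_bounded_lty source_open source_bounded.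

Lemma source_slice_bounded t : a <= t <= b ->
  measurable_fun D (fun y => S y t) /\ exists B : R, {ae vol, forall y, D y -> `|S y t| <= B}.
Proof. by have [_ _ HB _ _] := HS; exact: HB. Qed.

Lemma source_slice_continuous t0 : a <= t0 <= b -> forall e : R, 0 < e ->
  exists2 d : R, 0 < d & forall t, a <= t <= b -> `|t - t0| < d ->
    {ae vol, forall y, D y -> `|S y t - S y t0| <= e}.
Proof. by have [_ _ _ HC _] := HS; exact: HC. Qed.

Lemma source_positive : exists2 c : R, 0 < c & forall t, a <= t <= b ->
  {ae vol, forall y, D y -> c <= S y t}.
Proof. by have [_ _ _ _] := HS. Qed.

Lemma delay_bounded : exists M : R, forall t y, a <= t <= b -> D y -> `|t - dot3 xh y| <= M.
Proof.
have [M DM] := source_bounded; have /andP[a0 ab] := source_time.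
exists (b + (`|c1 xh| * M + `|c2 xh| * M + `|c3 xh| * M)) => t y /andP[ta tb] /DM[y1 [y2 y3]].
rewrite (le_trans (ler_normB _ _))// lerD//.
  by rewrite ger0_norm// (le_trans a0).
rewrite /dot3; apply: (le_trans (ler_normD _ _)); apply: lerD.
  by apply: (le_trans (ler_normD _ _)); apply: lerD; rewrite normrM ler_wpM2l.
by rewrite normrM ler_wpM2l.
Qed.

Lemma slice_integrable f t : loc_lipschitz f -> a <= t <= b ->
  vol.-integrable D (EFin \o (fun y => f (t - dot3 xh y) * S y t)).
Proof.
move=> hf tab; have [mS [B SB]] := source_slice_bounded tab.
have [M tM] := delay_bounded; have [K K0 fK] := loc_lipschitz_bounded M hf.
apply: (@ae_bounded_integrable _ _ _ _ _ mD _ (K * B) Doo).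
  apply: measurable_funM => //; apply: measurable_funTS.
  apply: measurableT_comp.
    by apply: continuous_measurable_fun; exact: loc_lipschitz_continuous.
  by apply: measurable_funB (measurable_dot3 _); exact: measurable_cst.
apply: (ae_impl SB) => y Dy Sy; rewrite normrM ler_pM//.
by apply: fK; exact: tM.
Qed.

Lemma slice_le f g t : loc_lipschitz f -> loc_lipschitz g -> a <= t <= b ->
  (forall y, D y -> f (t - dot3 xh y) <= g (t - dot3 xh y)) -> slice f t <= slice g t.
Proof.
move=> hf hg tab fg.
apply: (ae_le_Rintegral mD (slice_integrable hf tab) (slice_integrable hg tab)).
have [c c0 Sc] := source_positive.
apply: (ae_impl (Sc t tab)) => y Dy Sy; rewrite ler_wpM2r ?fg//.
exact: le_trans (ltW c0) Sy.
Qed.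

(** The increment of f S splits into f times the increment of [S], small by L^oo continuity in time,
    and the increment of [f] times [S] at the fixed time [t0], small by the Lipschitz bound.
    Integrability of the outer integrand rests on this. *)
Lemma slice_continuous f : loc_lipschitz f -> {within `[a, b], continuous (slice f)}.
Proof.
move=> hf; apply/subspace_continuousP => t0; rewrite /= in_itv/= => t0ab.
have [_ [B SB]] := source_slice_bounded t0ab.
have [M tM] := delay_bounded; have [K K0 fK] := loc_lipschitz_bounded M hf.
have [L L0 fL] := hf M.
pose V := fine (vol D).
have V0 : 0 <= V by exact: fine_ge0.
apply/cvgrPdist_le => e e0.
(* Each of the two parts gets [e / 2] after integration over volume [V]; the added 1 covers the case
   of a vanishing factor. *)
have K1 : 0 < K * V + 1 by rewrite ltr_wpDl// mulr_ge0.
have eK : 0 < e / 2 / (K * V + 1) by rewrite !divr_gt0.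
have B1 : 0 < L * `|B| * V + 1 by rewrite ltr_wpDl// !mulr_ge0.
have eB : 0 < e / 2 / (L * `|B| * V + 1) by rewrite !divr_gt0.
have [d d0 Hd] := source_slice_continuous t0ab eK.
have d1 : 0 < Num.min d (e / 2 / (L * `|B| * V + 1)) by rewrite lt_min d0.
rewrite near_withinE; near=> t => tab.
rewrite /= in_itv/= in tab.
have : `|t0 - t| < Num.min d (e / 2 / (L * `|B| * V + 1)).
  by near: t; exact: (@cvgr_dist_lt _ _ _ _ _ id).
rewrite lt_min distrC => /andP[td tB].
have SdH := Hd t tab td.
pose q := K * (e / 2 / (K * V + 1)) + L * `|t - t0| * `|B|.
have I0 := slice_integrable hf t0ab; have I1 := slice_integrable hf tab.
have Iq : vol.-integrable D (EFin \o (fun=> q)).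
  exact: (cst_integrable mD _ Doo).
have diff : {ae vol, forall y, D y ->
    `|f (t - dot3 xh y) * S y t - f (t0 - dot3 xh y) * S y t0| <= q}.
  apply: (ae_impl2 SdH SB) => y Dy Sd Sb.
  have -> : f (t - dot3 xh y) * S y t - f (t0 - dot3 xh y) * S y t0 =
    f (t - dot3 xh y) * (S y t - S y t0) + (f (t - dot3 xh y) - f (t0 - dot3 xh y)) * S y t0 by ring.
  rewrite (le_trans (ler_normD _ _))// !normrM /q lerD// ler_pM//.
  - by apply: fK; exact: tM.
  - have -> : t - t0 = (t - dot3 xh y) - (t0 - dot3 xh y) by ring.
    by apply: fL; exact: tM.
  - exact: le_trans Sb (ler_norm _).
have qV : q * V <= e.
  rewrite /q mulrDl [e in leRHS]splitr lerD//.
    rewrite mulrAC mulrA ler_pdivrMr// mulrC ler_wpM2l ?lerDl//.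
    by rewrite divr_ge0// ltW.
  rewrite ltW//; apply: (@le_lt_trans _ _ (`|t - t0| * (L * `|B| * V))); first by rewrite -!mulrA mulrCA.
  apply: (@le_lt_trans _ _ (`|t - t0| * (L * `|B| * V + 1))); first by rewrite ler_wpM2l// lerDl.
  by rewrite -ltr_pdivlMr.
apply: le_trans qV; rewrite distrC.
rewrite -[leRHS](Rintegral_cst vol mD) [X in `|X|](_ : _ =
   \int[vol]_(y in D) (f (t - dot3 xh y) * S y t - f (t0 - dot3 xh y) * S y t0)); last first.
  by rewrite RintegralB.
have Id := EFin_integrableB mD I1 I0.
rewrite ler_norml; apply/andP; split.
  rewrite -mulN1r -RintegralZl//; apply: ae_le_Rintegral => //.
    exact: (cst_integrable mD _ Doo).
  apply: (ae_impl diff) => y Dy; rewrite ler_norml mulN1r.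
  by case/andP.
apply: ae_le_Rintegral => //.
apply: (ae_impl diff) => y Dy; rewrite ler_norml.
by case/andP.
Unshelve. all: by end_near. Qed.

Let mI : measurable (`[a, b]%classic : set (measurableTypeR R)) := measurable_itv _.

Lemma slice_time_integrable f : loc_lipschitz f ->
  lebesgue_measure.-integrable `[a, b] (EFin \o slice f).
Proof.
move=> hf; apply: continuous_compact_integrable; first exact: segment_compact.
exact: slice_continuous.
Qed.

Lemma source_pairingD f g : loc_lipschitz f -> loc_lipschitz g ->
  pair (fun x => f x + g x) = pair f + pair g.
Proof.
move=> hf hg; rewrite /source_pairing -RintegralD//; [|exact: slice_time_integrable..].
apply: eq_Rintegral => t; rewrite inE/= in_itv/= => tab.
rewrite /slice_pairing.
rewrite -(RintegralD mD (slice_integrable hf tab) (slice_integrable hg tab)).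
by apply: eq_Rintegral => y _; rewrite mulrDl.
Qed.

Lemma source_pairingZ c f : loc_lipschitz f -> pair (fun x => c * f x) = c * pair f.
Proof.
move=> hf; rewrite /source_pairing -RintegralZl//; last exact: slice_time_integrable.
apply: eq_Rintegral => t; rewrite inE/= in_itv/= => tab.
rewrite /slice_pairing -(RintegralZl _ mD (slice_integrable hf tab)).
by apply: eq_Rintegral => y _; rewrite mulrA.
Qed.

Lemma source_pairing_le f g : loc_lipschitz f -> loc_lipschitz g ->
  (forall t y, a <= t <= b -> D y -> f (t - dot3 xh y) <= g (t - dot3 xh y)) ->
  pair f <= pair g.
Proof.
move=> hf hg fg; apply: le_Rintegral => //; [exact: slice_time_integrable..|].
move=> t /=; rewrite in_itv/= => tab; apply: slice_le => // y; exact: fg.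
Qed.

Lemma source_pairing1_ge0 : 0 <= pair (fun=> 1).
Proof.
have l c : loc_lipschitz (fun=> c : R) by exact: loc_lipschitz_cst.
rewrite (_ : 0 = pair (fun=> 0 * 1)); first by apply: source_pairing_le => // *; rewrite mul0r.
by rewrite (source_pairingZ 0 (l 1)) mul0r.
Qed.

(** Since [S] is positive, the pairing is monotone, and -e <= f <= e on the delays bounds it by [e]
    times the total mass [pair (fun=> 1)]. *)
Lemma source_pairing_functional M : (forall t y, a <= t <= b -> D y -> `|t - dot3 xh y| <= M) ->
  lip_functional M pair.
Proof.
move=> tM; split; [exact: source_pairingD|exact: source_pairingZ|].
have l c : loc_lipschitz (fun=> c : R) by exact: loc_lipschitz_cst.
have E c : pair (fun=> c) = c * pair (fun=> 1).
  have -> : (fun=> c) = (fun x : R => c * (fun=> 1) x) by apply/funext => x; rewrite mulr1.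
  exact: source_pairingZ.
exists (pair (fun=> 1)) => [|f e hf fe]; first exact: source_pairing1_ge0.
rewrite ler_norml mulrC -mulNr -!E; apply/andP.
by split; apply: source_pairing_le => // t y tab Dy;
  have := fe _ (tM t y tab Dy); rewrite ler_norml => /andP[].
Qed.

(** [k] bounds from below the source mass emitted from [U] during [a, a + h], where all delays lie
    below [s]. It is fixed before [f] and [m] because it must serve all powers (B - x)^n at once. *)
Lemma source_pairing_lower y0 (s : R) : D y0 -> a - dot3 xh y0 < s ->
  exists2 k : R, 0 < k & forall f (m : R), loc_lipschitz f -> 0 <= m ->
    (forall t y, a <= t <= b -> D y -> 0 <= f (t - dot3 xh y)) ->
    (forall t y, a <= t <= b -> D y -> t - dot3 xh y < s -> m <= f (t - dot3 xh y)) ->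
    m * k <= pair f.
Proof.
move=> Dy0 ys; have /andP[a0 ab] := source_time.
(* The gap is shared equally: at most [d] is lost by waiting until a + h, and less than [d] by
   moving from [y0] within [U]. *)
pose d := (s - (a - dot3 xh y0)) / 2.
have d0 : 0 < d by rewrite divr_gt0// subr_gt0.
pose U := D `&` [set y | dot3 xh y0 - d < dot3 xh y].
have oU : open U.
  apply/open3P => y [Dy /= yd].
  have [r r0 rD] := (open3P D).1 source_open y Dy.
  pose W := 1 + `|c1 xh| + `|c2 xh| + `|c3 xh|.
  have W0 : 0 < W by rewrite /W -!addrA ltr_pwDl// !addr_ge0.
  pose g := dot3 xh y - (dot3 xh y0 - d).
  have g0 : 0 < g by rewrite subr_gt0.
  exists (Num.min r (g / W)); first by rewrite lt_min r0 divr_gt0.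
  move=> z; rewrite !lt_min => /andP[z1 z1'] /andP[z2 z2'] /andP[z3 z3'].
  split; first exact: rD.
  have zg (p q : R) : `|q| < g / W -> - (`|p| * (g / W)) <= p * q.
    move=> qg; rewrite lerNl -mulrN (le_trans (ler_norm _))// normrM normrN.
    by rewrite ler_wpM2l// ltW.
  have gW : (`|c1 xh| + `|c2 xh| + `|c3 xh|) * (g / W) < g.
    by rewrite mulrA ltr_pdivrMr// mulrC ltr_pM2l// /W; lra.
  have := zg (c1 xh) _ z1'; have := zg (c2 xh) _ z2'; have := zg (c3 xh) _ z3'.
  rewrite /= /g in gW *; rewrite /dot3 in gW *; lra.
have U0 : U !=set0 by exists y0; split => //=; lra.
have UD : U `<=` D by move=> y [].
have mU : measurable (U : set (measurableTypeR R * measurableTypeR R * measurableTypeR R)%type) := open_measurable3 oU.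
have Ub : bounded3 U by have [M DM] := source_bounded; exists M => y /UD/DM.
have [c c0 Sc] := source_positive.
pose w := fine (vol U).
have w0 : 0 < w.
  by apply: fine_gt0; rewrite (vol3_open_gt0 oU U0)/=; exact: vol3_bounded_lty oU Ub.
pose h := Num.min d (b - a).
have h0 : 0 < h by rewrite lt_min d0 subr_gt0.
have hd : h <= d by rewrite ge_min lexx.
have hb : h <= b - a by rewrite ge_min lexx orbT.
pose I : set (measurableTypeR R) := `[a, a + h]%classic.
have mII : measurable I by exact: measurable_itv.
have II : I `<=` `[a, b]%classic.
  by move=> t; rewrite /I /= !in_itv/= => /andP[-> th]/=; lra.
exists (c * w * h); first by rewrite !mulr_gt0.
move=> f m hf m0 f0 fm.
have fmI : fine (lebesgue_measure I) = h.
  rewrite /I lebesgue_measure_itv/= lte_fin ltrDl h0 -EFinB/=; lra.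
rewrite -fmI mulrA -(Rintegral_cst_indic _ _ mII II)//.
apply: le_Rintegral => //; last first.
- move=> t /=; rewrite in_itv/= => tab.
  have slice0 : 0 <= slice f t.
    have := @slice_le (fun=> 0) f t (@loc_lipschitz_cst _ 0) hf tab (fun y Dy => f0 t y tab Dy).
    apply: le_trans; rewrite /slice_pairing (@eq_Rintegral _ _ _ _ _ (fun=> 0)).
      by rewrite Rintegral_cst// mul0r.
    by move=> y _; rewrite mul0r.
  rewrite indicE; case: (boolP (t \in I)) => [|_]; last by rewrite mulr0.
  rewrite inE /I /= in_itv/= => /andP[_ th].
  rewrite mulr1 mulrA -(Rintegral_cst_indic vol _ mU UD).
  apply: ae_le_Rintegral => //; last 2 first.
  - exact: slice_integrable.
  - apply: (ae_impl (Sc t tab)) => y Dy Sy; rewrite indicE.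
    have fy0 := f0 t y tab Dy.
    case: (boolP (y \in U)) => [|_]; last by rewrite mulr0 mulr_ge0// (le_trans (ltW c0)).
    rewrite inE => -[_ /= yd]; rewrite mulr1 ler_pM ?(ltW c0)//.
    apply: fm => //; rewrite /d in hd yd; lra.
  - exact: (cst_indic_integrable mD _ Doo mU).
- exact: slice_time_integrable.
- have fI : (lebesgue_measure (`[a, b]%classic : set R) < +oo)%E.
    by rewrite lebesgue_measure_itv/= lte_fin ab -EFinB ltry.
  exact: (cst_indic_integrable mI _ fI mII).
Qed.

End SourcePairing.

(** * Uniqueness *)

Section Uniqueness.
Context {R : realType}.

Lemma lip_functionalB (M : R) (L1 L2 : (R -> R) -> R) :
  lip_functional M L1 -> lip_functional M L2 -> lip_functional M (fun f => L1 f - L2 f).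
Proof.
move=> [D1 Z1 [K1 K10 H1]] [D2 Z2 [K2 K20 H2]]; split.
- by move=> f g hf hg; rewrite D1// D2// opprD addrACA.
- by move=> c f hf; rewrite Z1// Z2// mulrBr.
- exists (K1 + K2) => [|f e hf fe]; first exact: addr_ge0.
  rewrite (le_trans (ler_normB _ _))// mulrDl lerD//; first exact: H1.
  exact: H2.
Qed.

(** By Bernoulli, (1 + e / A)^n >= 1 + n e / A, which eventually exceeds K / k. *)
Lemma not_geometric_dominated (A e k K : R) : 0 < A -> 0 < e -> 0 < k ->
  ~ (forall n, (A + e) ^+ n * k <= A ^+ n * K).
Proof.
move=> A0 e0 k0 H.
have x0 : 0 < e / A by rewrite divr_gt0.
have bern n : 1 + n%:R * (e / A) <= (1 + e / A) ^+ n.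
  elim: n => [|n IH]; first by rewrite mul0r addr0 expr0.
  rewrite exprS; apply: (@le_trans _ _ ((1 + e / A) * (1 + n%:R * (e / A)))).
    rewrite -natr1 (_ : (1 + e / A) * _ = 1 + (n%:R + 1) * (e / A) + n%:R * (e / A) ^+ 2); last by ring.
    by rewrite lerDl mulr_ge0// sqr_ge0.
  by rewrite ler_wpM2l// addr_ge0// ltW.
have [n Kn] : exists n, K / k / (e / A) < n%:R.
  by exists (Num.truncn (K / k / (e / A))).+1; rewrite truncnS_gt.
have := H n; rewrite (_ : A + e = A * (1 + e / A)); last by field; rewrite gt_eqF.
rewrite exprMn -mulrA ler_pM2l ?exprn_gt0// leNgt => /negP; apply.
rewrite -ltr_pdivrMr//; apply: lt_le_trans (bern n).
by rewrite ltr_pdivrMr// in Kn; rewrite (lt_trans Kn)// ltrDr.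
Qed.

Lemma farfield_halfspace (D D' : set (pt R)) (S S' : pt R -> R -> R)
    (tmin tmax tmax' kmin kmax : R) (xh : pt R) :
  source_assumptions D S tmin tmax -> source_assumptions D' S' tmin tmax' ->
  kmin < kmax ->
  (forall k, kmin <= k <= kmax ->
     farfield D S tmin tmax xh k = farfield D' S' tmin tmax' xh k) ->
  forall c, (forall z, D' z -> dot3 xh z <= c) -> forall y, D y -> dot3 xh y <= c.
Proof.
move=> HS HS' kk eqF c D'c y Dy; rewrite leNgt; apply/negP => cy.
have [M1 tM1] := delay_bounded xh HS; have [M2 tM2] := delay_bounded xh HS'.
have /andP[_ tab] := source_time HS; have /andP[_ tab'] := source_time HS'.
pose M := Num.max M1 M2.
have tM t z : tmin <= t <= tmax -> D z -> `|t - dot3 xh z| <= M.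
  by move=> tt Dz; rewrite le_max tM1.
have tM' t z : tmin <= t <= tmax' -> D' z -> `|t - dot3 xh z| <= M.
  by move=> tt Dz; rewrite le_max tM2 ?orbT.
have t0 : tmin <= tmin <= tmax by rewrite lexx ltW.
have t0' : tmin <= tmin <= tmax' by rewrite lexx ltW.
have M0 : 0 <= M by exact: le_trans (tM _ _ t0 Dy).
have F1 := source_pairing_functional HS tM.
have F2 := source_pairing_functional HS' tM'.
have F := lip_functionalB F1 F2.
have s2pi : (Num.sqrt (2 * pi))^-1 != 0 :> R.
  by rewrite invr_eq0 gt_eqF// sqrtr_gt0 mulr_gt0// pi_gt0.
(* [B - x] is nonnegative on all delays of both sources, so its powers are monotone; the extra 1
   makes [A] below strictly positive. *)
pose B := M + 1.
have powE n : source_pairing D S tmin tmax xh (fun x => (B - x) ^+ n) =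
    source_pairing D' S' tmin tmax' xh (fun x => (B - x) ^+ n).
  apply/eqP; rewrite -subr_eq0; apply/eqP.
  rewrite (_ : (fun x => (B - x) ^+ n) = horner ((B%:P - 'X) ^+ n)).
    apply: (moments_vanish F M0 _ _ _ kk) => k /eqF[/(mulfI s2pi) ck /(mulfI s2pi) sk].
      by apply/eqP; rewrite subr_eq0; apply/eqP; exact: ck.
    by apply/eqP; rewrite subr_eq0; apply/eqP; exact: sk.
  by apply/funext => x; rewrite horner_exp !hornerE.
have lB n : loc_lipschitz (fun x => (B - x) ^+ n).
  rewrite (_ : (fun x => (B - x) ^+ n) = horner ((B%:P - 'X) ^+ n)); first exact: loc_lipschitz_horner.
  by apply/funext => x; rewrite horner_exp !hornerE.
pose e := (dot3 xh y - c) / 2.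
have e0 : 0 < e by rewrite divr_gt0// subr_gt0.
(* Delays from D' are at least [tmin - c], so [A] is the largest value [B - x] can take there; the
   source in [D] has positive mass where [B - x] is at least [A + e]. *)
pose A := B - tmin + c.
have A0 : 0 < A.
  have [z Dz] := source_nonempty HS'; have := tM' _ _ t0' Dz; have := D'c z Dz.
  by rewrite ler_norml /A /B => h /andP[_ h']; lra.
have ys : tmin - dot3 xh y < tmin - c - e by rewrite /e; lra.
have [k k0 low] := source_pairing_lower HS Dy ys.
(* The chain is (A + e)^n k <= n-th moment for [D] = n-th moment for D' <= A^n times the total mass
   for D'. *)
apply: (@not_geometric_dominated A e k (source_pairing D' S' tmin tmax' xh (fun=> 1))) => // n.
have Bpos x : `|x| <= M -> 0 <= B - x.
  by rewrite ler_norml /B => /andP[_ h]; lra.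
apply: (@le_trans _ _ (source_pairing D S tmin tmax xh (fun x => (B - x) ^+ n))).
  apply: low => //; first by rewrite exprn_ge0// addr_ge0// ltW.
    by move=> t z tt Dz; rewrite exprn_ge0// Bpos// tM.
  move=> t z tt Dz ts; have AeB : A + e <= B - (t - dot3 xh z) by rewrite /A; lra.
  by rewrite lerXn2r// nnegrE; [rewrite addr_ge0// ltW|rewrite Bpos// tM].
have l1 : loc_lipschitz (fun=> 1 : R) by exact: loc_lipschitz_cst.
rewrite powE -(source_pairingZ _ HS' _ l1).
apply: (source_pairing_le HS') => //.
  by apply: loc_lipschitzM l1; exact: loc_lipschitz_cst.
move=> t z tt Dz; rewrite mulr1 lerXn2r// ?nnegrE ?(ltW A0) ?Bpos ?tM'//.
have := D'c z Dz; case/andP: tt => h _; rewrite /A => h'; lra.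
Qed.

End Uniqueness.

Unset Implicit Arguments.

Theorem mainTheorem8 (R : realType) (D D' : set (pt R)) (S S' : pt R -> R -> R)
    (tmin tmax tmax' kmin kmax : R) :
  source_assumptions D S tmin tmax ->
  source_assumptions D' S' tmin tmax' ->
  0 <= kmin -> kmin < kmax ->
  (forall (xh : pt R) (k : R), on_sphere2 xh -> kmin <= k <= kmax ->
     farfield D S tmin tmax xh k = farfield D' S' tmin tmax' xh k) ->
  convex_hull3 D = convex_hull3 D'.
Proof.
move=> HS HS' _ kk eqF; apply/seteqP; split; apply: convex_hull3_sub.
- apply: (sub_convex_hull3_of_halfspaces (source_open HS) (source_open HS')
    (source_nonempty HS') (source_bounded HS')) => v c v1.
  by apply: (farfield_halfspace HS HS' kk) => k kb; exact: eqF.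
- apply: (sub_convex_hull3_of_halfspaces (source_open HS') (source_open HS)
    (source_nonempty HS) (source_bounded HS)) => v c v1.
  by apply: (farfield_halfspace HS' HS kk) => k kb; rewrite eqF.
Qed.
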